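(* Let $L$ be a finite-dimensional reductive Lie algebra over a field of characteristic $0$ and let $L=Z\oplus L_1\oplus\dots\oplus L_k$ be its decomposition into the center $Z$ and simple components $L_1,\dots,L_k$. A linear operator $J$ on $L$ is Lie-orthogonal on $L$ if and only if it can be represented in the form \[ J=J_0\oplus J_1\oplus\dots\oplus J_k+J_Z, \] where for each $i=1,\dots,k$ either $J_i=\mathrm{Id}_{L_i}$ or $J_i=-\mathrm{Id}_{L_i}$, $J_0$ is the identically zero operator on $Z$, and $J_Z$ is an arbitrary linear operator on $L$ whose image is contained in the center $Z$.
   Context: A linear operator $J$ on a Lie algebra $L$ is called Lie-orthogonal if $[Jx,Jy]=[x,y]$ for all $x,y\in L$. For a direct sum of ideals, $J_0\oplus J_1\oplus\dots\oplus J_k$ denotes the operator acting as $J_0$ on $Z$ and as $J_i$ on $L_i$. *)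

(* Defs.v *)
From HB Require Import structures.
From mathcomp Require Import all_boot all_order all_algebra.
Set Implicit Arguments.
Unset Strict Implicit.
Unset Printing Implicit Defensive.
Import GRing.Theory.
Local Open Scope ring_scope.

HB.mixin Record Vector_isLieAlgebra (F : fieldType) (L : Type)
    of Vector F L := {
  lieb : L -> L -> L;
  lieb_linear_l : forall y : L, linear (fun x : L => lieb x y);
  lieb_linear_r : forall x : L, linear (lieb x);
  liebb : forall x : L, lieb x x = 0;
  lieb_jacobi : forall x y z : L,
    lieb x (lieb y z) + lieb y (lieb z x) + lieb z (lieb x y) = 0
}.

(** Finite-dimensional Lie algebras over a field. *)
#[short(type="lieAlgType")]
HB.structure Definition LieAlgebra (F : fieldType) :=
  { L of Vector F L & Vector_isLieAlgebra F L }.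

Notation "[lie x , y ]" := (lieb x y)
  (at level 0, x, y at level 99, format "[lie  x ,  y ]") : ring_scope.

Section LieAlgebraTheory.
Variables (F : fieldType) (L : lieAlgType F).
Implicit Types (x y z : L) (I S U V : {vspace L}) (J : 'End(L)).

Definition lie_ad x : 'End(L) := linfun (fun y : L => [lie x, y]).

Definition lie_center : {vspace L} := lker (linfun lie_ad).

Lemma lie_adE x y : lie_ad x y = [lie x, y].
Proof.
pose B := GRing.isLinear.Build F L L _ (fun y : L => [lie x, y])
  (@lieb_linear_r F L x).
pose f : {linear L -> L} := HB.pack (fun y : L => [lie x, y]) B.
exact: (lfunE f).
Qed.

Lemma lie_ad_linear : linear lie_ad.
Proof.
move=> a x x'; apply/lfunP => y.
by rewrite add_lfunE scale_lfunE !lie_adE lieb_linear_l.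
Qed.

Lemma lie_centerP x :
  reflect (forall y, [lie x, y] = 0) (x \in lie_center).
Proof.
pose B := GRing.isLinear.Build F L _ _ lie_ad lie_ad_linear.
pose f : {linear L -> 'End(L)} := HB.pack lie_ad B.
have adE : linfun lie_ad x = lie_ad x by exact: (lfunE f).
rewrite memv_ker adE; apply: (iffP eqP) => [ad0 y | br0].
  by rewrite -lie_adE ad0 lfunE.
by apply/lfunP => y; rewrite lie_adE br0 lfunE.
Qed.

Definition lie_ideal I : Prop :=
  forall x y, y \in I -> [lie x, y] \in I.

(** The subspace spanned by the brackets of elements of [U] and [V]; by
    bilinearity brackets of basis vectors suffice. *)
Definition lie_prodv U V : {vspace L} :=
  <<[seq [lie u, v] | u <- vbasis U, v <- vbasis V]>>%VS.

Definition lie_solvable U : Prop :=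
  exists n : nat, iter n (fun V => lie_prodv V V) U = 0%VS.

Definition lie_is_radical R : Prop :=
  [/\ lie_ideal R, lie_solvable R
    & forall I, lie_ideal I -> lie_solvable I -> (I <= R)%VS].

(** The radical of [L] is its center. *)
Definition lie_reductive : Prop := lie_is_radical lie_center.

(** [S], assumed to be a subalgebra, is simple as a Lie algebra in its own
    right: the ideals [I] are those of [S], not of [L]. *)
Definition lie_simple S : Prop :=
  (exists x y, [/\ x \in S, y \in S & [lie x, y] != 0]) /\
  (forall I, (I <= S)%VS ->
     (forall x y, x \in S -> y \in I -> [lie x, y] \in I) ->
     I = 0%VS \/ I = S).

(** [L] is the direct sum of its center and of the simple ideals [Ls i]. *)
Definition lie_reductive_decomposition (k : nat) (Ls : 'I_k -> {vspace L})
    : Prop :=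
  [/\ forall i, lie_ideal (Ls i),
      forall i, lie_simple (Ls i),
      (lie_center + \sum_(i < k) Ls i)%VS = fullv
    & directv (lie_center + \sum_(i < k) Ls i)].

Definition lie_orthogonal J : Prop :=
  forall x y, [lie J x, J y] = [lie x, y].

Definition acts_as J V (T : 'End(subvs_of V)) : Prop :=
  forall u : subvs_of V, J (vsval u) = vsval (T u).

(** [D] is the operator [J0 (+) J_1 (+) ... (+) J_k] on
    [Z (+) L_1 (+) ... (+) L_k]. *)
Definition is_direct_sum_op (k : nat) (Z : {vspace L})
    (Ls : 'I_k -> {vspace L}) (J0 : 'End(subvs_of Z))
    (Js : forall i, 'End(subvs_of (Ls i))) (D : 'End(L)) : Prop :=
  acts_as D J0 /\ forall i, acts_as D (Js i).

End LieAlgebraTheory.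

Arguments lie_center {F} L.
Arguments lie_reductive {F} L.

(* Main.v *)
(* For Lie-orthogonal J with inverse J', the operator N = J - J' satisfies
   [N x, y] = - [x, N y]; call such operators skew.  On a simple Lie algebra
   skew operators vanish:
   - for skew N and K, NK + KN lies in the centroid, while NK - KN and
     [ad x, N] are skew;
   - expanding the skew operator [ad (N x), K] shows that P = KN - NK satisfies
     ad (P x) = - T on brackets, with T in the centroid; then T kills P x, and
     Schur's lemma yields P = 0, i.e. skew operators commute;
   - N commutes with [ad x, N], and it anticommutes with it because N^2 is in
     the centroid, so N [ad x, N] = 0; if N were injective it would be both
     skew and in the centroid, hence 0.  So products of skew operators vanish,
     and the common kernel of all skew operators is an ideal containing im N.
   Hence J^2 = 1; the Jacobi identities then put J in the centroid, so J = +-1.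

   For reductive L = Z + S with projection pi onto S along Z, the operator
   pi J pi + (1 - pi) is again Lie-orthogonal, is bijective, and preserves each
   simple component, which reduces the theorem to the simple case. *)

Require Import Defs.
From HB Require Import structures.
From mathcomp Require Import all_boot all_order all_algebra.
From mathcomp Require Import ring zify.
Set Implicit Arguments.
Unset Strict Implicit.
Unset Printing Implicit Defensive.
Import GRing.Theory VectorInternalTheory.
Local Open Scope ring_scope.

(* [ring] needs a commutative ring, so the identity is checked coordinatewise. *)
Ltac zmod_ring :=
  apply: v2r_inj; apply/rowP => ?;
  rewrite ?(raddfD v2r, raddfN v2r, raddf0 v2r) ?mxE; ring.

(** * Bracket identities, the centroid and skew operators *)

Section LieBracket.
Variables (F : fieldType) (L : lieAlgType F).
Implicit Types (x y z : L) (J N T : 'End(L)).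

Lemma liebDl x y z : [lie x + y, z] = [lie x, z] + [lie y, z].
Proof. by have := lieb_linear_l z 1 x y; rewrite !scale1r. Qed.

Lemma liebDr x y z : [lie x, y + z] = [lie x, y] + [lie x, z].
Proof. by have := lieb_linear_r x 1 y z; rewrite !scale1r. Qed.

Lemma lieb0l x : [lie 0, x] = 0.
Proof. by apply: (addrI [lie 0, x]); rewrite -liebDl !addr0. Qed.

Lemma lieb0r x : [lie x, 0] = 0.
Proof. by apply: (addrI [lie x, 0]); rewrite -liebDr !addr0. Qed.

Lemma liebNl x y : [lie - x, y] = - [lie x, y].
Proof. by apply: (addrI [lie x, y]); rewrite -liebDl !subrr lieb0l. Qed.

Lemma liebNr x y : [lie x, - y] = - [lie x, y].
Proof. by apply: (addrI [lie x, y]); rewrite -liebDr !subrr lieb0r. Qed.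

Lemma liebBl x y z : [lie x - y, z] = [lie x, z] - [lie y, z].
Proof. by rewrite liebDl liebNl. Qed.

Lemma liebBr x y z : [lie x, y - z] = [lie x, y] - [lie x, z].
Proof. by rewrite liebDr liebNr. Qed.

Lemma liebZl a x y : [lie a *: x, y] = a *: [lie x, y].
Proof. by have := lieb_linear_l y a x 0; rewrite !addr0 lieb0l addr0. Qed.

Lemma liebZr a x y : [lie x, a *: y] = a *: [lie x, y].
Proof. by have := lieb_linear_r x a y 0; rewrite !addr0 lieb0r addr0. Qed.

Lemma lieb_suml (I : Type) (r : seq I) (P : pred I) (f : I -> L) y :
  [lie \sum_(i <- r | P i) f i, y] = \sum_(i <- r | P i) [lie f i, y].
Proof.
exact: (big_morph (fun x => [lie x, y]) (fun x z => liebDl x z y) (lieb0l y)).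
Qed.

Lemma lieb_sumr (I : Type) (r : seq I) (P : pred I) (f : I -> L) x :
  [lie x, \sum_(i <- r | P i) f i] = \sum_(i <- r | P i) [lie x, f i].
Proof. exact: (big_morph _ (liebDr x) (lieb0r x)). Qed.

Lemma liebC x y : [lie x, y] = - [lie y, x].
Proof.
apply/eqP; rewrite -addr_eq0; apply/eqP.
by have := liebb (x + y); rewrite liebDl !liebDr !liebb add0r addr0.
Qed.

Lemma lieb_jacobil x y z :
  [lie [lie x, y], z] = [lie x, [lie y, z]] - [lie y, [lie x, z]].
Proof.
have := lieb_jacobi x y z; rewrite (liebC z x) (liebC z [lie x, y]) liebNr => jac.
by apply/eqP; rewrite -subr_eq0 -oppr0 -jac; apply/eqP; zmod_ring.
Qed.

Lemma lieb_der x y z :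
  [lie x, [lie y, z]] = [lie y, [lie x, z]] - [lie z, [lie x, y]].
Proof. rewrite (liebC z) lieb_jacobil; zmod_ring. Qed.

Lemma mem_lie_prodv (U V : {vspace L}) x y :
  x \in U -> y \in V -> [lie x, y] \in lie_prodv U V.
Proof.
move=> /coord_vbasis-> /coord_vbasis->; rewrite lieb_suml; apply: memv_suml => i _.
rewrite lieb_sumr; apply: memv_suml => j _; rewrite liebZl liebZr !memvZ //.
by apply/memv_span/allpairs_f; rewrite ?mem_nth ?size_tuple.
Qed.

(** Skew-adjointness for the bracket seen as a vector-valued form; equivalently, [[lie N x, y]] is
    symmetric in [x] and [y]. *)
Definition lie_skew N := forall x y, [lie N x, y] = - [lie x, N y].

Definition lie_centroid T := forall x y, T [lie x, y] = [lie x, T y].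

Lemma lie_centroidl T x y : lie_centroid T -> T [lie x, y] = [lie T x, y].
Proof. by move=> cT; rewrite [in LHS]liebC raddfN /= cT [RHS]liebC. Qed.

Lemma lker_centroid_ideal T : lie_centroid T -> lie_ideal (lker T).
Proof. by move=> cT x y; rewrite !memv_ker cT => /eqP->; rewrite lieb0r. Qed.

(** Writing [y] as [J (J^-1 y)] shows that the adjoint of an injective orthogonal [J] is its
    inverse. *)
Lemma lie_orthogonal_adj J x y : lie_orthogonal J -> lker J == 0%VS ->
  [lie J x, y] = [lie x, (J^-1)%VF y].
Proof. by move=> oJ kJ; rewrite -{1}(lker0_lfunVK kJ y) oJ. Qed.

(** Add the Jacobi identities for [(J x, J y, z)] and [(J x, y, J z)] and subtract those for
    [(x, J y, J z)] and [(x, y, z)]: since [J] is self-adjoint, only the stated terms survive. *)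
Lemma lie_orthogonal_involution J x y z : lie_orthogonal J ->
  (forall u, J (J u) = u) ->
  [lie J x, [lie J y, z]] + [lie J x, [lie J y, z]] =
    [lie x, [lie y, z]] + [lie x, [lie y, z]].
Proof.
move=> oJ JJ.
have adjJ u v : [lie J u, v] = [lie u, J v] by rewrite -{1}(JJ v) oJ.
have j1 := lieb_jacobi (J x) (J y) z.
have j2 := lieb_jacobi (J x) y (J z).
have j3 := lieb_jacobi x (J y) (J z).
have j4 := lieb_jacobi x y z.
rewrite !oJ in j1 j2 j3; rewrite -(adjJ y) in j2; rewrite (adjJ z) -(adjJ x) in j3.
apply/eqP; rewrite -subr_eq0; apply/eqP.
transitivity ([lie J x, [lie J y, z]] + [lie J y, [lie z, J x]] + [lie z, [lie x, y]]
  + ([lie J x, [lie J y, z]] + [lie y, [lie z, x]] + [lie J z, [lie J x, y]])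
  - ([lie x, [lie y, z]] + [lie J y, [lie z, J x]] + [lie J z, [lie J x, y]])
  - ([lie x, [lie y, z]] + [lie y, [lie z, x]] + [lie z, [lie x, y]])).
  zmod_ring.
by rewrite j1 j2 j3 j4 !subr0 addr0.
Qed.

Lemma lie_skew_br N x y : lie_skew N -> [lie N x, y] = [lie N y, x].
Proof. by move=> sN; rewrite sN [RHS]liebC. Qed.

(** Expanding each term by Jacobi gives six brackets that cancel in pairs by the symmetry of
    [[lie N u, v]]. *)
Lemma lie_skew_cyclic N x y z : lie_skew N ->
  [lie N x, [lie y, z]] + [lie N y, [lie z, x]] + [lie N z, [lie x, y]] = 0.
Proof.
move=> sN.
have step u v w : [lie N u, [lie v, w]] =
    [lie v, [lie N w, u]] - [lie w, [lie N v, u]].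
  by rewrite (lie_skew_br w u) // (lie_skew_br v u) // -lieb_der.
rewrite !step (lie_skew_br x y) // (lie_skew_br x z) // (lie_skew_br y z) //.
zmod_ring.
Qed.

Lemma lie_skewB N K : lie_skew N -> lie_skew K -> lie_skew (N - K).
Proof.
move=> sN sK x y; rewrite !add_lfunE !opp_lfunE liebBl liebBr sN sK.
zmod_ring.
Qed.

Lemma lie_skew_comm N K :
  lie_skew N -> lie_skew K -> lie_skew ((N \o K)%VF - (K \o N)%VF).
Proof.
move=> sN sK x y; rewrite !add_lfunE !opp_lfunE !comp_lfunE liebBl liebBr.
rewrite sN sK (sK (N x)) sN; zmod_ring.
Qed.

(** [lie_ad x] is a derivation, and the commutator of a derivation with a skew operator is skew. *)
Lemma lie_skew_der N x : lie_skew N ->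
  lie_skew ((lie_ad x \o N)%VF - (N \o lie_ad x)%VF).
Proof.
move=> sN y z; rewrite !add_lfunE !opp_lfunE !comp_lfunE !lie_adE liebBl liebBr.
rewrite (sN [lie x, y]) opprK !lieb_jacobil !sN liebNr; zmod_ring.
Qed.

End LieBracket.

(** * Skew and Lie-orthogonal operators on a simple Lie algebra *)

Section Simple.
Variables (F : fieldType) (S : lieAlgType F).
Hypothesis two_neq0 : (2%:R : F) != 0.
Hypothesis simpleS : lie_simple (fullv : {vspace S}).
Implicit Types (x y z : S) (J N K T : 'End(S)).

Lemma ideal_trivial (I : {vspace S}) : lie_ideal I -> I = 0%VS \/ I = fullv.
Proof.
by case: simpleS => _ trivI idI; apply: trivI; rewrite ?subvf // => x y _ /idI.
Qed.

Lemma nonabelian : exists x y : S, [lie x, y] != 0.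
Proof. by case: simpleS => -[x [y [_ _ xy]]] _; exists x, y. Qed.

Lemma lker_fullv (f : 'End(S)) : lker f = fullv -> f = 0.
Proof.
move=> kT; apply/lfunP => x; rewrite lfunE; apply/eqP.
by rewrite -memv_ker kT memvf.
Qed.

Lemma double_eq0 x : x + x = 0 -> x = 0.
Proof.
move=> /eqP; rewrite -mulr2n -scaler_nat scaler_eq0 (negbTE two_neq0).
by move/eqP.
Qed.

Lemma centerless x : (forall y, [lie x, y] = 0) -> x = 0.
Proof.
move/lie_centerP; have [|->|full] := ideal_trivial (I := lie_center S).
- move=> u v /lie_centerP v0; apply/lie_centerP => w.
  by rewrite lieb_jacobil !v0 lieb0r subrr.
- by rewrite memv0 => /eqP.
have [u [v /eqP[]]] := nonabelian.
by apply/lie_centerP; rewrite full memvf.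
Qed.

Lemma lieb_inj x y : (forall z, [lie z, x] = [lie z, y]) -> x = y.
Proof.
move=> xy; apply/eqP; rewrite -subr_eq0; apply/eqP/centerless => z.
by rewrite liebC liebBr xy subrr oppr0.
Qed.

(** A form of [[S, S] = S]: the kernel of [f] contains all brackets, so it is a nonzero ideal. *)
Lemma perfect (f : 'End(S)) : (forall x y, f [lie x, y] = 0) -> f = 0.
Proof.
move=> f0; have [|k0|kT] := ideal_trivial (I := lker f).
- by move=> x y _; rewrite memv_ker f0.
- have [u [v]] := nonabelian.
  by rewrite -memv0 -k0 memv_ker f0 eqxx.
exact: lker_fullv.
Qed.

(** Schur's lemma: the kernel of [T] is an ideal. *)
Lemma centroid_eq0 T x : lie_centroid T -> T x = 0 -> x != 0 -> T = 0.
Proof.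
move=> cT Tx0 nx0; have [k0|kT] := ideal_trivial (lker_centroid_ideal cT).
  by move: nx0; rewrite -memv0 -k0 memv_ker Tx0 eqxx.
exact: lker_fullv.
Qed.

Lemma skew_anticomm_centroid N K : lie_skew N -> lie_skew K ->
  lie_centroid ((N \o K)%VF + (K \o N)%VF).
Proof.
move=> sN sK y z; apply: lieb_inj => x.
(* The cyclic identity for [N'] at [K' x], [y], [z]; skewness of [K'] then moves it off [x]. *)
have half N' K' : lie_skew N' -> lie_skew K' ->
    [lie N' (K' x), [lie y, z]] =
      [lie N' y, [lie K' z, x]] - [lie N' z, [lie K' y, x]].
  move=> sN' sK'; have /eqP := lie_skew_cyclic (K' x) y z sN'.
  rewrite -addrA addr_eq0 => /eqP->.
  by rewrite (liebC z) !(lie_skew_br x) // liebNr; zmod_ring.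
rewrite !add_lfunE !comp_lfunE !liebDr.
have -> : [lie x, N (K [lie y, z])] = [lie K (N x), [lie y, z]].
  by rewrite sK sN opprK.
have -> : [lie x, K (N [lie y, z])] = [lie N (K x), [lie y, z]].
  by rewrite sN sK opprK.
rewrite !half //.
have -> : [lie y, N (K z)] = - [lie N y, K z] by rewrite sN opprK.
have -> : [lie y, K (N z)] = - [lie K y, N z] by rewrite sK opprK.
rewrite !liebNr (liebC x) (liebC x [lie K y, N z]) !lieb_jacobil !opprK.
zmod_ring.
Qed.

Lemma skew_commute N K : lie_skew N -> lie_skew K -> (N \o K = K \o N)%VF.
Proof.
move=> sN sK; apply/lfunP => x; apply/esym/eqP; rewrite !comp_lfunE -subr_eq0.
pose P := (K \o N)%VF - (N \o K)%VF.
have PE u : P u = K (N u) - N (K u) by rewrite !add_lfunE opp_lfunE !comp_lfunE.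
have sP : lie_skew P by exact: lie_skew_comm.
pose dN := (lie_ad x \o N)%VF - (N \o lie_ad x)%VF.
pose dK := (lie_ad x \o K)%VF - (K \o lie_ad x)%VF.
pose T := (N \o dK)%VF + (dK \o N)%VF.
have sdN : lie_skew dN by exact: lie_skew_der.
have sdK : lie_skew dK by exact: lie_skew_der.
have TE u : T u = N (dK u) + dK (N u) by rewrite add_lfunE !comp_lfunE.
have cT : lie_centroid T by exact: skew_anticomm_centroid.
(* [Q] is chosen so that [P \o lie_ad x = Q + N \o dK] with [Q] skew. *)
pose Q := ((lie_ad (N x) \o K)%VF - (K \o lie_ad (N x))%VF)
  - ((K \o dN)%VF - (dN \o K)%VF).
have sQ : lie_skew Q.
  by apply: lie_skewB; [exact: lie_skew_der | exact: lie_skew_comm].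
have P_ad z : P [lie x, z] = Q z + N (dK z).
  rewrite PE !(add_lfunE, opp_lfunE, comp_lfunE, lie_adE) !raddfB /= !sN.
  rewrite raddfN /=.
  zmod_ring.
have PxT y z : [lie P x, [lie y, z]] = T [lie z, y].
  have cyc := lie_skew_cyclic x y z sP.
  (* The skew [Q] cancels, and the remainder [N \o dK] contributes exactly [T]. *)
  have : [lie P [lie x, z], y] + [lie z, P [lie x, y]] = [lie z, T y].
    rewrite !P_ad TE liebDl !liebDr sQ sN sdK.
    zmod_ring.
  rewrite -cT => <-; apply/eqP; rewrite -subr_eq0 -cyc; apply/eqP.
  rewrite (lie_skew_br _ y) // (liebC x z) liebNr -(opprK [lie z, P _]) -sP.
  zmod_ring.
have adP : lie_ad (P x) + T = 0.
  apply: perfect => y z; rewrite add_lfunE lie_adE PxT (liebC z) raddfN.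
  by rewrite addNr.
(* Evaluate [adP] at [P x], where [[lie P x, P x] = 0]. *)
have TP : T (P x) = 0.
  have /lfunP/(_ (P x)) := adP.
  by rewrite add_lfunE lie_adE liebb add0r zero_lfunE.
rewrite -PE; apply: contraT => Px0.
suff: P x = 0 by move/eqP; rewrite (negbTE Px0).
apply: centerless => y; rewrite -lie_adE.
by have := adP; rewrite (centroid_eq0 cT TP Px0) addr0 => ->; rewrite lfunE.
Qed.

Lemma skew_sqr_centroid N : lie_skew N -> lie_centroid (N \o N)%VF.
Proof.
move=> sN y z; apply/eqP; rewrite -subr_eq0; apply/eqP/double_eq0.
have := skew_anticomm_centroid sN sN y z; rewrite !add_lfunE liebDr => /eqP.
by rewrite -subr_eq0 => /eqP <-; zmod_ring.
Qed.

Lemma skew_mul_der N x z : lie_skew N ->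
  N ([lie x, N z] - N [lie x, z]) = 0.
Proof.
move=> sN; pose dN := (lie_ad x \o N)%VF - (N \o lie_ad x)%VF.
have dNE u : dN u = [lie x, N u] - N [lie x, u].
  by rewrite add_lfunE opp_lfunE !comp_lfunE !lie_adE.
rewrite -dNE; apply: double_eq0.
have /lfunP/(_ z) := skew_commute sN (lie_skew_der x sN).
rewrite !comp_lfunE => {2}->; rewrite !dNE raddfB /=.
have := skew_sqr_centroid sN x z; rewrite !comp_lfunE => ->; zmod_ring.
Qed.

Lemma skew_sqr0 N : lie_skew N -> (N \o N = 0)%VF.
Proof.
move=> sN; have cN := skew_sqr_centroid sN.
have [k0|] := ideal_trivial (lker_centroid_ideal cN); last exact: lker_fullv.
have N_inj x : N x = 0 -> x = 0.
  by move=> Nx0; apply/eqP; rewrite -memv0 -k0 memv_ker comp_lfunE Nx0 raddf0.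
have cen : lie_centroid N.
  move=> x y; apply/eqP; rewrite eq_sym -subr_eq0; apply/eqP/N_inj.
  exact: skew_mul_der.
suff -> : N = 0 by rewrite comp_lfun0l.
apply: perfect => x y; apply: double_eq0.
by rewrite {1}lie_centroidl // sN cen addNr.
Qed.

(** Polarisation: [(N - K)^2 = 0] reduces to [N K + K N = 0], and [N] and [K] commute. *)
Lemma skew_mul0 N K : lie_skew N -> lie_skew K -> (N \o K = 0)%VF.
Proof.
move=> sN sK; apply/lfunP => x; rewrite comp_lfunE [RHS]lfunE.
apply: double_eq0.
have /lfunP/(_ x) := skew_sqr0 (lie_skewB sN sK).
rewrite lfunE /= !(add_lfunE, opp_lfunE) !raddfB /=.
have /lfunP/(_ x) := skew_sqr0 sN; rewrite !lfunE /= => ->.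
have /lfunP/(_ x) := skew_sqr0 sK; rewrite !lfunE /= => ->.
have /lfunP/(_ x) := skew_commute sN sK; rewrite !comp_lfunE => <-.
by move=> /(congr1 -%R); rewrite oppr0 => <-; zmod_ring.
Qed.

Lemma skew_eq0 N : lie_skew N -> N = 0.
Proof.
move=> sN.
pose killed (U : {vspace S}) := forall K, lie_skew K -> (U <= lker K)%VS.
(* Induction on the codimension of a killed subspace containing the image of [N]; it stands in for
   the common kernel of all skew operators. *)
suff H d (U : {vspace S}) : (\dim {:S} - \dim U <= d)%N ->
    (limg N <= U)%VS -> killed U -> N = 0.
  apply: (H _ _ (leqnn _) (subvv _)) => K sK.
  apply/subvP => _ /memv_imgP[x _ ->].
  by rewrite memv_ker -comp_lfunE skew_mul0 // lfunE.
elim: d U => [|d IH] U codimU NU kU.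
  apply: lker_fullv; apply/eqP; rewrite eqEdim subvf /=.
  by rewrite (leq_trans _ (dimvS (kU N sN))) // -subn_eq0 -leqn0.
pose W := (U + lie_prodv fullv U)%VS.
have UW : (U <= W)%VS by rewrite addvSl.
have kW : killed W.
  move=> K sK; rewrite subv_add kU //=.
  apply/span_subvP => _ /allpairsP[[x u] /= [_ /vbasis_mem uU ->]].
  have K0 K' : lie_skew K' -> K' u = 0.
    by move=> sK'; apply/eqP; rewrite -memv_ker; apply: subvP uU; apply: kU.
  (* The skew commutator of [lie_ad x] with [K] also kills [u], whence [K [lie x, u] = 0]. *)
  have := K0 _ (lie_skew_der x sK).
  rewrite !(add_lfunE, opp_lfunE, comp_lfunE, lie_adE) K0 // lieb0r add0r.
  by rewrite memv_ker => /eqP; rewrite oppr_eq0.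
have [WU|nWU] := boolP (W <= U)%VS; last first.
  apply: (IH W) => //; last exact: subv_trans UW.
  have ltUW : (\dim U < \dim W)%N.
    by rewrite (ltn_leqif (dimv_leqif_sup UW)).
  have := dimvS (subvf W); lia.
(* [U] no longer grows, so it is an ideal: zero or everything, and [N] vanishes in both cases. *)
have idU : lie_ideal U.
  move=> x u uU; apply: subvP WU _ _; rewrite -[X in X \in _]add0r.
  by rewrite memv_add ?mem0v ?mem_lie_prodv ?memvf.
have [U0|UT] := ideal_trivial idU.
  apply/lfunP => x; rewrite lfunE; apply/eqP.
  by rewrite -memv0 -U0 (subvP NU) ?memv_img ?memvf.
by apply: lker_fullv; apply/eqP; rewrite eqEsubv subvf -UT kU.
Qed.

Lemma lie_orthogonal_simple J : lie_orthogonal J -> J = \1%VF \/ J = - \1%VF.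
Proof.
move=> oJ.
have kJ : lker J == 0%VS.
  apply/lker0P => x y Jxy; apply: lieb_inj => z.
  by rewrite -oJ Jxy oJ.
have adjJ x y := lie_orthogonal_adj x y oJ kJ.
have JV : J = (J^-1)%VF.
  apply/eqP; rewrite -subr_eq0; apply/eqP/skew_eq0 => x y.
  have adjV : [lie (J^-1)%VF x, y] = [lie x, J y] by rewrite liebC -adjJ -liebC.
  by rewrite !(add_lfunE, opp_lfunE) liebBl liebBr adjJ adjV opprB.
have adjJ' x y : [lie J x, y] = [lie x, J y] by rewrite adjJ {2}JV.
have JJ x : J (J x) = x by rewrite {1}JV lker0_lfunK.
(* As [J] is its own inverse, it can be stripped from both sides, which are then compared by
   bracketing with [x]. *)
have cJ : lie_centroid J.
  move=> y z; rewrite -adjJ' -[RHS]JJ; congr (J _); apply: lieb_inj => x.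
  rewrite -adjJ'.
  apply/esym/eqP; rewrite -subr_eq0; apply/eqP/double_eq0.
  have /eqP := lie_orthogonal_involution x y z oJ JJ.
  by rewrite -subr_eq0 => /eqP <-; zmod_ring.
have cJ1 : lie_centroid (J - \1)%VF.
  by move=> x y; rewrite !(add_lfunE, opp_lfunE, id_lfunE) liebBr cJ.
have [k0|kT] := ideal_trivial (lker_centroid_ideal cJ1).
  (* Here [J - 1] is injective, and [(J - 1)(J + 1) = 0]. *)
  right; apply/lfunP => x; rewrite opp_lfunE id_lfunE.
  apply/eqP; rewrite -addr_eq0 -memv0 -k0 memv_ker.
  rewrite !(add_lfunE, opp_lfunE, id_lfunE) raddfD /= JJ.
  by rewrite (addrC (J x)) subrr.
by left; apply/eqP; rewrite -subr_eq0; apply/eqP/lker_fullv.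
Qed.

End Simple.

(** * An ideal as a Lie algebra in its own right *)

Section IdealAlgebra.
Variables (F : fieldType) (L : lieAlgType F) (I : {vspace L}).
Hypothesis idI : lie_ideal I.

(** [vsproj] only serves to type the result: for an ideal the bracket already lies in [I]. *)
Definition ideal_lieb (u v : subvs_of I) : subvs_of I :=
  vsproj I [lie vsval u, vsval v].

Lemma vsval_ideal_lieb u v : vsval (ideal_lieb u v) = [lie vsval u, vsval v].
Proof. by rewrite vsprojK // idI // subvsP. Qed.

Fact ideal_lieb_linear_l v : linear (fun u => ideal_lieb u v).
Proof.
move=> a u u'; apply: subvs_inj; rewrite [RHS]linearP /= !vsval_ideal_lieb.
exact: (lieb_linear_l (vsval v) a (vsval u) (vsval u')).
Qed.

Fact ideal_lieb_linear_r u : linear (ideal_lieb u).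
Proof.
move=> a v v'; apply: subvs_inj; rewrite [RHS]linearP /= !vsval_ideal_lieb.
exact: (lieb_linear_r (vsval u) a (vsval v) (vsval v')).
Qed.

Fact ideal_liebb u : ideal_lieb u u = 0.
Proof. by apply: subvs_inj; rewrite vsval_ideal_lieb liebb. Qed.

Fact ideal_lieb_jacobi u v w : ideal_lieb u (ideal_lieb v w)
  + ideal_lieb v (ideal_lieb w u) + ideal_lieb w (ideal_lieb u v) = 0.
Proof.
apply: subvs_inj; rewrite !raddfD /= !vsval_ideal_lieb; exact: lieb_jacobi.
Qed.

Definition ideal_lieAlg : lieAlgType F := HB.pack (subvs_of I)
  (Vector_isLieAlgebra.Build F (subvs_of I) ideal_lieb_linear_l
     ideal_lieb_linear_r ideal_liebb ideal_lieb_jacobi).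

(** Ideals of [ideal_lieAlg] are pushed into [L] along the inclusion, where simplicity of [I]
    applies; injectivity brings the conclusion back. *)
Lemma ideal_lieAlg_simple :
  lie_simple I -> lie_simple (fullv : {vspace ideal_lieAlg}).
Proof.
case=> -[x [y [xI yI xy]]] trivI; split.
  exists (vsproj I x), (vsproj I y); split; rewrite ?memvf //.
  apply: contra_neq xy => /(congr1 vsval).
  by rewrite [LHS]vsval_ideal_lieb linear0 !vsprojK.
move=> U _ idU; pose iota := linfun (vsval : subvs_of I -> L).
have iota_inj : lker iota == 0%VS.
  by apply/lker0P => u v; rewrite !lfunE; apply: val_inj.
have [||U0|UT] := trivI (iota @: (U : {vspace subvs_of I}))%VS.
- by apply/subvP => _ /memv_imgP[u _ ->]; rewrite lfunE subvsP.
- move=> u _ uI /memv_imgP[v vU ->]; apply/memv_imgP.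
  exists (ideal_lieb (vsproj I u) v); first by apply: idU; rewrite ?memvf.
  by rewrite !lfunE /= vsval_ideal_lieb vsprojK.
- left; apply/eqP; rewrite -dimv_eq0 -(limg_dim_eq (f := iota)) ?U0 ?dimv0 //.
  by rewrite (eqP iota_inj) capv0.
- right; apply/eqP; rewrite eqEsubv subvf; apply/subvP => u _.
  have : iota u \in (iota @: (U : {vspace subvs_of I}))%VS.
    by rewrite UT lfunE subvsP.
  by case/memv_imgP => v vU /(lker0P iota_inj) ->.
Qed.

Lemma lie_orthogonal_simple_ideal (J : 'End(L)) : (2%:R : F) != 0 ->
    lie_simple I -> {in I, forall x, J x \in I} -> lie_orthogonal J ->
  {in I, forall x, J x = x} \/ {in I, forall x, J x = - x}.
Proof.
move=> two_neq0 simI JI oJ.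
pose JI' : 'End(subvs_of I) :=
  (linfun (vsproj I) \o (J \o linfun (vsval : subvs_of I -> L)))%VF.
have JE u : vsval (JI' u) = J (vsval u).
  by rewrite !comp_lfunE !lfunE vsprojK // JI // subvsP.
have oJI : @lie_orthogonal F ideal_lieAlg JI'.
  move=> u v; apply: val_inj.
  by rewrite [LHS]vsval_ideal_lieb [RHS]vsval_ideal_lieb !JE.
have [J1|J1] := lie_orthogonal_simple two_neq0 (ideal_lieAlg_simple simI) oJI.
- left=> x xI; have := JE (vsproj I x); rewrite vsprojK // => <-.
  by rewrite J1 id_lfunE vsprojK.
- right=> x xI; have := JE (vsproj I x); rewrite vsprojK // => <-.
  by rewrite J1 opp_lfunE id_lfunE linearN /= vsprojK.
Qed.

End IdealAlgebra.

(** * Reductive algebras: reduction to the simple components *)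

Section ReductiveDecomposition.
Variables (F : fieldType) (L : lieAlgType F) (k : nat) (Ls : 'I_k -> {vspace L}).
Hypothesis Ldec : lie_reductive_decomposition Ls.
Implicit Types (i j : 'I_k) (x y z : L) (J D : 'End(L)).

Local Notation Z := (lie_center L).
Local Notation Lss := (\sum_(i < k) Ls i)%VS.

Lemma center_lieb0l z x : z \in Z -> [lie z, x] = 0.
Proof. by move/lie_centerP. Qed.

Lemma center_lieb0r z x : z \in Z -> [lie x, z] = 0.
Proof. by move=> zZ; rewrite liebC center_lieb0l // oppr0. Qed.

Lemma semisimple_cap_center : (Lss :&: Z)%VS = 0%VS.
Proof.
case: Ldec => _ _ _; rewrite directv_addE => /and3P[_ _ /eqP].
by rewrite capvC.
Qed.

Lemma component_cap i j : i != j -> (Ls i :&: Ls j)%VS = 0%VS.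
Proof.
move=> ij; case: Ldec => _ _ _.
rewrite directv_addE => /and3P[_ /directv_sumP dx _].
apply/eqP; rewrite -subv0 -(dx i isT) capvS //.
by apply: (sumv_sup j); rewrite // eq_sym.
Qed.

Lemma component_lieb0 i j x y :
  i != j -> x \in Ls i -> y \in Ls j -> [lie x, y] = 0.
Proof.
case: Ldec => idL _ _ _ ij xi yj; apply/eqP; rewrite -memv0 -(component_cap ij).
by rewrite memv_cap (idL j) // liebC rpredN idL.
Qed.

Lemma component_sub i : (Ls i <= Lss)%VS.
Proof. exact: (sumv_sup i). Qed.

Lemma reductiveP x :
  exists z u, [/\ z \in Z, forall i, u i \in Ls i & x = z + \sum_i u i].
Proof.
have : x \in (Z + Lss)%VS by case: Ldec => _ _ LE _; rewrite LE memvf.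
case/memv_addP => z zZ [_ /memv_sumP[u uL ->] ->].
by exists z, u; split=> // i; apply: uL.
Qed.

(** Such an [x] also commutes with the center and the other components, so it is central, and the
    center meets the sum of the components in 0. *)
Lemma component_center0 i x : x \in Ls i ->
  (forall y, y \in Ls i -> [lie x, y] = 0) -> x = 0.
Proof.
move=> xi x0; apply/eqP; rewrite -memv0 -semisimple_cap_center memv_cap.
rewrite (subvP (component_sub i)) //; apply/lie_centerP => y.
have [z [u [zZ uL ->]]] := reductiveP y.
rewrite liebDr (center_lieb0r _ zZ) add0r lieb_sumr big1 // => j _.
have [<-|ij] := eqVneq i j; first exact: x0.
exact: component_lieb0 ij xi (uL j).
Qed.

(** For [j != i] the component [u j] of [J x] commutes with [Ls j]: its bracket with [y] in [Ls j]
    equals [[lie x, J^-1 y]], so it lies in both [Ls i] and [Ls j]. *)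
Lemma orthogonal_component_stable J i x : lie_orthogonal J -> lker J == 0%VS ->
  J x \in Lss -> x \in Ls i -> J x \in Ls i.
Proof.
move=> oJ kJ /memv_sumP[u uL Jx] xi; have {}uL j : u j \in Ls j by apply: uL.
rewrite Jx (bigD1 i) //= big1 ?addr0 // => j ji.
apply: (component_center0 (uL j)) => y yj.
have -> : [lie u j, y] = [lie J x, y].
  rewrite Jx lieb_suml (bigD1 j) //= big1 ?addr0 // => m mj.
  exact: component_lieb0 mj (uL m) yj.
case: Ldec => idL _ _ _.
apply/eqP; rewrite -memv0 -(component_cap ji) memv_cap idL //=.
by rewrite lie_orthogonal_adj // liebC rpredN idL.
Qed.

(* The operators J_0 (+) J_1 (+) ... (+) J_k of the theorem. *)
Definition lie_signed D :=
  {in Z, forall z, D z = 0} /\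
  forall i, {in Ls i, forall x, D x = x} \/ {in Ls i, forall x, D x = - x}.

(** Brackets across different components vanish; inside one component the two equal signs multiply
    to 1. *)
Lemma signed_orthogonal D : lie_signed D -> lie_orthogonal D.
Proof.
case=> DZ DL x y.
have [z [u [zZ uL ->]]] := reductiveP x; have [t [v [tZ vL ->]]] := reductiveP y.
rewrite !raddfD /= (DZ z zZ) (DZ t tZ) !add0r !liebDl !liebDr !(center_lieb0l _ zZ).
rewrite !(center_lieb0r _ tZ) !add0r !raddf_sum /= !lieb_suml.
apply: eq_bigr => i _; rewrite !lieb_sumr; apply: eq_bigr => j _.
have DLs m w : w \in Ls m -> D w \in Ls m.
  by move=> wm; case: (DL m) => ->; rewrite ?rpredN.
have [<-|ij] := eqVneq i j; last by rewrite !(component_lieb0 ij) ?DLs.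
by case: (DL i) => DE; rewrite !DE // liebNl liebNr opprK.
Qed.

Lemma orthogonal_signed J : (2%:R : F) != 0 -> lie_orthogonal J ->
  exists2 D, lie_signed D & (limg (J - D) <= Z)%VS.
Proof.
move=> two_neq0 oJ; pose pi := daddv_pi Lss Z.
have pi_mem x : pi x \in Lss by exact: memv_pi.
have pi_id x : x \in Lss -> pi x = x.
  exact: daddv_pi_id semisimple_cap_center.
have pi_center x : x - pi x \in Z.
  have xLZ : x \in (Lss + Z)%VS.
    by case: Ldec => _ _ LE _; rewrite addvC LE memvf.
  have := daddv_pi_add semisimple_cap_center xLZ; rewrite -/pi => {1}<-.
  by rewrite addrC addKr memv_pi.
have pi0 z : z \in Z -> pi z = 0.
  move=> zZ; apply/eqP; rewrite -memv0 -semisimple_cap_center memv_cap pi_mem.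
  by rewrite -(subKr z (pi z)) rpredB.
have lieb_pil x y : [lie pi x, y] = [lie x, y].
  rewrite -[in RHS](subrK (pi x) x) liebDl.
  by rewrite (center_lieb0l _ (pi_center x)) add0r.
have lieb_pir x y : [lie x, pi y] = [lie x, y] by rewrite liebC lieb_pil -liebC.
pose D := (pi \o J \o pi)%VF.
have DE x : D x = pi (J (pi x)) by rewrite !comp_lfunE.
(* [D] kills the center; the added projection onto it leaves brackets unchanged and makes [J']
   injective. *)
pose J' := D + (\1 - pi)%VF.
have J'E x : J' x = D x + (x - pi x).
  by rewrite !(add_lfunE, opp_lfunE) id_lfunE.
have lieb_D x y : [lie D x, D y] = [lie x, y].
  by rewrite !DE lieb_pil lieb_pir oJ lieb_pil lieb_pir.
have oJ' : lie_orthogonal J'.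
  move=> x y; rewrite !J'E liebDl (center_lieb0l _ (pi_center x)) addr0.
  by rewrite liebDr (center_lieb0r _ (pi_center y)) addr0 lieb_D.
have kJ' : lker J' == 0%VS.
  rewrite -subv0; apply/subvP => x; rewrite memv_ker J'E => /eqP J'x0.
  have piD : pi (D x) = D x by rewrite pi_id // DE.
  have Dx0 : D x = 0.
    have := congr1 pi J'x0.
    by rewrite raddfD /= piD (pi0 _ (pi_center x)) addr0 raddf0.
  move: J'x0; rewrite Dx0 add0r => /subr0_eq xpi.
  (* [x] lies in the sum of the components and, since [D] preserves brackets, in the center. *)
  rewrite -semisimple_cap_center memv_cap xpi pi_mem -xpi.
  by apply/lie_centerP => y; rewrite -lieb_D Dx0 lieb0l.
have JZ z : z \in Z -> J z \in Z.
  (* Every [y] is some [J' w], and [[lie J z, J' w] = [lie z, pi w] = 0]. *)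
  move=> zZ; apply/lie_centerP => y; rewrite -[y](lker0_lfunVK kJ').
  set w := (J'^-1)%VF y; rewrite J'E liebDr (center_lieb0r _ (pi_center w)) addr0.
  by rewrite DE lieb_pir oJ center_lieb0l.
have DL i x : x \in Ls i -> J' x = D x.
  by move=> xi; rewrite J'E pi_id ?subrr ?addr0 // (subvP (component_sub i)).
exists D.
  split=> [z zZ|i]; first by rewrite DE (pi0 z) // !raddf0.
  have idLi : lie_ideal (Ls i) by case: Ldec.
  have simLi : lie_simple (Ls i) by case: Ldec.
  have stable : {in Ls i, forall x, J' x \in Ls i}.
    move=> x xi; apply: orthogonal_component_stable => //.
    by rewrite (DL i) // DE pi_mem.
  by case: (lie_orthogonal_simple_ideal idLi two_neq0 simLi stable oJ') => J'x;
    [left|right] => x xi; rewrite -(DL i) // J'x.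
(* [J x - D x] splits into [J (x - pi x)] and [J (pi x) - pi (J (pi x))], both central. *)
apply/subvP => _ /memv_imgP[x _ ->]; rewrite add_lfunE opp_lfunE DE.
have -> : J x = J (x - pi x) + J (pi x) by rewrite -raddfD subrK.
by rewrite -addrA rpredD // JZ.
Qed.

End ReductiveDecomposition.

Theorem corollary11 (F : fieldType) (charF0 : [pchar F] =i pred0)
    (L : lieAlgType F) (Lred : lie_reductive L)
    (k : nat) (Ls : 'I_k -> {vspace L})
    (Ldec : lie_reductive_decomposition Ls) (J : 'End(L)) :
  lie_orthogonal J <->
  exists (J0 : 'End(subvs_of (lie_center L)))
         (Js : forall i : 'I_k, 'End(subvs_of (Ls i)))
         (D JZ : 'End(L)),
    [/\ J0 = 0,
        forall i, Js i = \1%VF \/ Js i = - \1%VF,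
        is_direct_sum_op J0 Js D,
        (limg JZ <= lie_center L)%VS
      & J = D + JZ].
Proof.
split=> [oJ|[J0 [Js [D [JZ [-> Js1 [DZ DL] imJZ ->]]]]]].
- have two_neq0 : (2%:R : F) != 0.
    by apply/negP => two0; have := charF0 2; rewrite !inE two0.
  have [D [DZ DL] imJD] := orthogonal_signed Ldec two_neq0 oJ.
  pose Js i : 'End(subvs_of (Ls i)) :=
    (linfun (vsproj (Ls i)) \o (D \o linfun (vsval : subvs_of (Ls i) -> L)))%VF.
  have JsE i u : Js i u = vsproj (Ls i) (D (vsval u)).
    by rewrite !comp_lfunE !lfunE.
  have Js_sign i : (Js i = \1%VF /\ {in Ls i, forall x, D x = x})
      \/ (Js i = - \1%VF /\ {in Ls i, forall x, D x = - x}).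
    case: (DL i) => DE; [left|right]; split=> //; apply/lfunP => u.
      by rewrite JsE DE ?subvsP // vsvalK id_lfunE.
    by rewrite JsE DE ?subvsP // raddfN /= vsvalK opp_lfunE id_lfunE.
  exists 0, Js, D, (J - D); split=> //; last by rewrite addrC subrK.
    by move=> i; case: (Js_sign i) => -[-> _]; [left|right].
  split=> [u|i u]; first by rewrite zero_lfunE raddf0 DZ // subvsP.
  by case: (Js_sign i) => -[-> ->]; rewrite ?subvsP // !(opp_lfunE, id_lfunE).
(* Converse: [JZ] has central values, so only [D] matters for brackets. *)
have sD : lie_signed Ls D.
  split=> [z zZ|i].
    by have := DZ (vsproj _ z); rewrite vsprojK // zero_lfunE raddf0.
  case: (Js1 i) => JE; [left|right] => x xi; have := DL i (vsproj _ x);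
  by rewrite JE ?opp_lfunE id_lfunE ?raddfN /= vsprojK.
move=> x y; have JZ0 w : JZ w \in lie_center L.
  by rewrite (subvP imJZ) // memv_img ?memvf.
rewrite !add_lfunE liebDl !liebDr !(center_lieb0l _ (JZ0 x)).
by rewrite (center_lieb0r _ (JZ0 y)) !addr0 (signed_orthogonal Ldec sD).
Qed.
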